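(* Let a network $P$, a consensus matrix $N$ and a class $\mathcal{O}_{m,L}$ be given such that Assumptions 1–4 below hold. Let $K$ be a controller with minimal realization $(A_c,B_c,C_c,D_c)$ such that $F\star(P\star K)$ is well-posed and convergent for all $F\in\mathcal{O}_{m,L}$, as certified by the Robust Stability condition and the Regulator Equations below, and let $(\Pi,\Theta,\Gamma,\Phi)$ be the unique solution of the Regulator Equations. Then there exist 1. an internal model system $\Sigma_{\min}$ that depends only on $(\Pi,\Gamma,\Phi)$, and 2. a core subcontroller $\Sigma_{\mathrm{core}}$ whose state-space matrices lie in the $\Theta$-parameterized affine space $\mathcal{L}_{\mathrm{core}}(\Theta)$, such that $K$ factors as the cascade $K=\Sigma_{\min}\Sigma_{\mathrm{core}}$. Explicitly, let $R=(R_1\ R_2)\in\mathbb{R}^{sc\times sc}$ be an invertible matrix with $\mathrm{ran}(R_1)=\mathrm{null}(\Phi)$, $r:=\dim\mathrm{null}(\Phi)$, $\Gamma R=(\Gamma_1\ \Gamma_2)$, $\Phi R=(0\ \Phi_2)$. Then there is an invertible matrix $Q$ with $Q^{-1}\Theta R=\begin{pmatrix}-I_r&\Theta_{12}\\0&\Theta_{22}\end{pmatrix}$, and the factorization holds with the system $\Sigma_{\min}$ from input $\tilde u=(\tilde u^1,\tilde u^2)$ to output $u$ given by $$\eta_{k+1}=\eta_k+\tilde u^1_k,\qquad u_k=-\Gamma_1\eta_k+\tilde u^2_k,\qquad \eta_k\in\mathbb{R}^r,$$ and a system $\Sigma_{\mathrm{core}}$ from input $y$ to output $\tilde u$ given by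 $\zeta_{k+1}=A_{\mathrm{core}}\zeta_k+B_{\mathrm{core}}y_k$, $\tilde u^j_k=C_{\mathrm{core},j}\zeta_k+D_{\mathrm{core},j}y_k$ ($j=1,2$), whose matrices satisfy the affine constraint $\mathcal{L}_{\mathrm{core}}(\Theta)$: $$A_{\mathrm{core}}\Theta_{22}+B_{\mathrm{core}}\Phi_2=\Theta_{22},\qquad C_{\mathrm{core},1}\Theta_{22}+D_{\mathrm{core},1}\Phi_2=0,\qquad C_{\mathrm{core},2}\Theta_{22}+D_{\mathrm{core},2}\Phi_2=\Gamma_1\Theta_{12}+\Gamma_2 .$$
   Context: Function classes. Let $\mathbf{q}(x)=\frac12\|x\|^2$ on $\mathbb{R}^c$. For $m\in\mathbb{R}$, $L\in(m,\infty]$, $\mathcal{S}_{m,L}$ is the class of $f:\mathbb{R}^c\to\mathbb{R}\cup\{\pm\infty\}$ such that $f-m\mathbf{q}$ is proper, convex and closed (p.c.c.) and, if $L<\infty$, also $L\mathbf{q}-f$ is p.c.c.; $\partial f:=\partial(f-m\mathbf{q})+mI$ with the convex subdifferential on the right. Fix $s,c\ge1$ and $m=(m_1,\dots,m_s)$, $L=(L_1,\dots,L_s)$ with $m_i\in\mathbb{R}$, $L_i\in(m_i,\infty]$, $\sum_i m_i>0$. $\mathcal{O}_{m,L}$ is the class of operators $F:\mathbb{R}^{sc}\rightrightarrows\mathbb{R}^{sc}$, $F(z)=\partial f_1(z^1)\times\cdots\times\partial f_s(z^s)$ with $f_i\in\mathcal{S}_{m_i,L_i}$, for which there is a unique pair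 $(\beta^*,w^* )\in\mathbb{R}^c\times\mathbb{R}^{sc}$ with $\sum_i w_i^*=0$, $w_i^*\in\partial f_i(\beta^* )$ for all $i$. $\mathcal{O}_{m,L}^0$ is the subset of $F\in\mathcal{O}_{m,L}$ with $f_i(0)=0$ for all $i$ and $0\in F(0)$. Consensus matrix: $N\in\mathbb{R}^{sc\times(s-1)c}$ with $\mathrm{rank}(N)=(s-1)c$ and $\mathrm{ran}(N)=\mathrm{null}((\mathbf{1}_s\otimes I_c)^\top)$ (empty if $s=1$). Interconnection. The network $P$ is $x^N_{k+1}=Ax^N_k+B_1w_k+B_2u_k$, $z_k=C_1x^N_k+D_1w_k+D_{12}u_k$, $y_k=C_2x^N_k+D_{21}w_k+D_2u_k$ with $w_k,z_k\in\mathbb{R}^{sc}$; the controller $K$ is $\xi_{k+1}=A_c\xi_k+B_cy_k$, $u_k=C_c\xi_k+D_cy_k$. $P\star K$ is well-posed if $I-D_2D_c$ is invertible; eliminating $(u,y)$ gives $x_{k+1}=\mathcal{A}x_k+\mathcal{B}w_k$, $z_k=\mathcal{C}x_k+\mathcal{D}w_k$ with $x_k=(x^N_k,\xi_k)$, $\mathcal{D}=D_1+D_{12}D_c(I-D_2D_c)^{-1}D_{21}$. The algorithm $F\star(P\star K)$ is this system together with $w_k\in F(z_k)$; it is well-posed if $P\star K$ is well-posed and $(F^{-1}-\mathcal{D})^{-1}$ is globally continuous (exactly one value at every point, and continuous), where $F^{-1}(x)=\{y\mid x\in F(y)\}$. It is convergent if there are $(x^*,z^*,w^* )$ with $x^*=\mathcal{A}x^*+\mathcal{B}w^*$,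 $z^*=\mathcal{C}x^*+\mathcal{D}w^*$, $w^*\in F(z^* )$, $z^*=\mathbf{1}_s\otimes\beta^*$, $(\mathbf{1}_s\otimes I_c)^\top w^*=0$ and $\lim_{k\to\infty}(x_k,w_k,z_k)=(x^*,w^*,z^* )$ for all $x_0$. Robust Stability: $I-D_2D_c$ is invertible and for all $\tilde F\in\mathcal{O}^0_{m,L}$, $\tilde F\star(P\star K)$ is well-posed with $\lim_k(x^N_k,\xi_k)=0$ for all initial states. Regulator Equations: there is a unique tuple $(\Pi,\Theta,\Gamma,\Phi)$ with $A\Pi+(0\ B_1N)+B_2\Gamma=\Pi$, $C_1\Pi+(\mathbf{1}_s\otimes I_c\ \ D_1N)+D_{12}\Gamma=0$, $C_2\Pi+(0\ D_{21}N)+D_2\Gamma=\Phi$, $A_c\Theta+B_c\Phi=\Theta$, $C_c\Theta+D_c\Phi=\Gamma$. Assumptions. Put $\mathbf{m}:=\mathrm{diag}(m)\otimes I_c$. Assumption 1: $E(\mathbf{m}):=I-D_1\mathbf{m}$ is invertible. With $W:=\mathbf{m}E(\mathbf{m})^{-1}$ set $A^{\mathbf m}=A+B_1WC_1$, $B_2^{\mathbf m}=B_2+B_1WD_{12}$, $C_2^{\mathbf m}=C_2+D_{21}WC_1$, $B_1^{\mathbf m}=(0\ \ B_1N)+B_1W(\mathbf{1}_s\otimes I_c\ \ D_1N)$, $D_{21}^{\mathbf m}=(0\ \ D_{21}N)+D_{21}W(\mathbf{1}_s\otimes I_c\ \ D_1N)$. Assumption 2: $(A^{\mathbf m},B_2^{\mathbf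 m})$ is stabilizable and $(A^{\mathbf m},C_2^{\mathbf m})$ is detectable. Assumption 3: $\begin{pmatrix}A-I&B_2\\C_1&D_{12}\end{pmatrix}$ has full column rank. Assumption 4: the pair $\left(\begin{pmatrix}A^{\mathbf m}&B_1^{\mathbf m}\\0&I_{cs}\end{pmatrix},\ (C_2^{\mathbf m}\ \ D_{21}^{\mathbf m})\right)$ is detectable. (Discrete-time notions throughout.) Cascade. $\Sigma_{\min}\Sigma_{\mathrm{core}}$ is the series connection feeding the output $\tilde u$ of $\Sigma_{\mathrm{core}}$ into $\Sigma_{\min}$; $K=\Sigma_{\min}\Sigma_{\mathrm{core}}$ means that the state-space description of the cascade with state $(\eta,\zeta)$ agrees with $(A_c,B_c,C_c,D_c)$ up to an invertible change of state coordinates (namely it equals $(Q^{-1}A_cQ,Q^{-1}B_c,C_cQ,D_c)$). A realization is minimal if it is controllable and observable. *)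

(* Defs.v *)
From HB Require Import structures.
From mathcomp Require Import all_boot all_order all_algebra.
From mathcomp Require Import complex mxtens.
From mathcomp Require Import all_classical all_reals all_analysis.

Set Implicit Arguments.
Unset Strict Implicit.
Unset Printing Implicit Defensive.

Import Order.TTheory GRing.Theory Num.Theory.
Import numFieldNormedType.Exports.

Local Open Scope classical_set_scope.
Local Open Scope ring_scope.

Definition ran (R : realType) m n (A : 'M[R]_(m, n)) : set 'cV[R]_m :=
  [set A *m u | u in setT].

Definition null (R : realType) m n (A : 'M[R]_(m, n)) : set 'cV[R]_n :=
  [set v | A *m v = 0].

(* [kermx] is the row kernel, whence the transpose. *)
Definition dim_null (R : realType) m n (A : 'M[R]_(m, n)) : nat :=
  \rank (kermx A^T).

(* Two-sided inverse; the dimensions m and n are then provably, but not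
   necessarily definitionally, equal (e.g. n = r + k). *)
Definition inverse_mx (R : realType) m n (A : 'M[R]_(m, n)) (B : 'M[R]_(n, m)) :=
  A *m B = 1%:M /\ B *m A = 1%:M.

Definition invertible_mx (R : realType) m n (A : 'M[R]_(m, n)) :=
  exists B : 'M[R]_(n, m), inverse_mx A B.

(* 1_s (x) I_c; [castmx] only turns the number of columns 1 * c into c. *)
Definition ones_kron (R : realType) s c : 'M[R]_(s * c, c) :=
  castmx (erefl, mul1n c) ((const_mx 1 : 'cV[R]_s) *t (1%:M : 'M[R]_c)).

Definition diag_kron (R : realType) s c (m : 'I_s -> R) : 'M[R]_(s * c) :=
  diag_mx (\row_i m i) *t (1%:M : 'M[R]_c).

(* The i-th block z^i in R^c of z in R^{sc}. *)
Definition blk (R : realType) s c (z : 'cV[R]_(s * c)) (i : 'I_s) : 'cV[R]_c :=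
  \col_j z (mxtens_index (i, j)) 0.

Definition dot (R : realType) c (u v : 'cV[R]_c) : R := (u^T *m v) 0 0.

(* The matrix norm of the library is the max-norm, hence the explicit
   Euclidean square. *)
Definition quad (R : realType) c (x : 'cV[R]_c) : R := 2^-1 * dot x x.

Definition epigraph (R : realType) c (g : 'cV[R]_c -> \bar R) :
    set ('cV[R]_c * R^o) :=
  [set p | (g p.1 <= (p.2 : R)%:E)%E].

Definition proper_fun (R : realType) c (g : 'cV[R]_c -> \bar R) :=
  (forall x, (-oo < g x)%E) /\ (exists x, (g x < +oo)%E).

Definition pcc (R : realType) c (g : 'cV[R]_c -> \bar R) :=
  [/\ proper_fun g, convex_set (epigraph g) & closed (epigraph g)].

Definition minus_quad (R : realType) c (m : R) (f : 'cV[R]_c -> \bar R) :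
    'cV[R]_c -> \bar R :=
  fun x => (f x - (m * quad x)%:E)%E.

Definition class_S (R : realType) c (m : R) (L : \bar R) :
    set ('cV[R]_c -> \bar R) :=
  [set f | pcc (minus_quad m f) /\
           forall l : R, L = l%:E -> pcc (fun x => (l * quad x)%:E - f x)%E].

Definition convex_subdiff (R : realType) c (g : 'cV[R]_c -> \bar R)
    (x : 'cV[R]_c) : set 'cV[R]_c :=
  [set v | forall y, (g x + (dot v (y - x))%:E <= g y)%E].

(* The subdifferential of f such that f - m q is convex:
   d(f - m q)(x) + m x. *)
Definition subdiff (R : realType) c (m : R) (f : 'cV[R]_c -> \bar R)
    (x : 'cV[R]_c) : set 'cV[R]_c :=
  [set v + m *: x | v in convex_subdiff (minus_quad m f) x].

Definition operator (R : realType) n := 'cV[R]_n -> set 'cV[R]_n.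

Definition subdiff_prod (R : realType) s c (m : 'I_s -> R)
    (f : 'I_s -> 'cV[R]_c -> \bar R) : operator R (s * c) :=
  fun z => [set w | forall i, subdiff (m i) (f i) (blk z i) (blk w i)].

Definition consensus_point (R : realType) s c (m : 'I_s -> R)
    (f : 'I_s -> 'cV[R]_c -> \bar R) (bw : 'cV[R]_c * 'cV[R]_(s * c)) :=
  \sum_i blk bw.2 i = 0 /\
  forall i, subdiff (m i) (f i) bw.1 (blk bw.2 i).

Definition represents (R : realType) s c (m : 'I_s -> R) (L : 'I_s -> \bar R)
    (f : 'I_s -> 'cV[R]_c -> \bar R) (F : operator R (s * c)) :=
  [/\ forall i, class_S (m i) (L i) (f i),
      F = subdiff_prod m f
    & exists! bw, consensus_point m f bw].

Definition class_O (R : realType) s c (m : 'I_s -> R) (L : 'I_s -> \bar R) :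
    set (operator R (s * c)) :=
  [set F | exists f, represents m L f F].

Definition class_O0 (R : realType) s c (m : 'I_s -> R) (L : 'I_s -> \bar R) :
    set (operator R (s * c)) :=
  [set F | exists f, [/\ represents m L f F, forall i, f i 0 = 0%E & F 0 0]].

Definition inv_op (R : realType) n (F : operator R n) : operator R n :=
  fun x => [set y | F y x].

Definition sub_lin (R : realType) n (F : operator R n) (D : 'M[R]_n) :
    operator R n :=
  fun x => [set y - D *m x | y in F x].

Definition globally_continuous (R : realType) n (F : operator R n) :=
  exists g : 'cV[R]_n -> 'cV[R]_n, continuous g /\ forall x, F x = [set g x].

Definition schur (R : realType) n (A : 'M[R]_n) :=
  forall l : complex R,
    eigenvalue (map_mx (real_complex R) A) l -> `|l| < 1.

Definition stabilizable (R : realType) n p (A : 'M[R]_n) (B : 'M[R]_(n, p)) :=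
  exists G : 'M[R]_(p, n), schur (A + B *m G).

Definition detectable (R : realType) n p (A : 'M[R]_n) (C : 'M[R]_(p, n)) :=
  exists G : 'M[R]_(n, p), schur (A + G *m C).

Definition controllable (R : realType) n p (A : 'M[R]_n) (B : 'M[R]_(n, p)) :=
  \rank (\mxrow_(j < n) (A ^+ j *m B)) = n.

Definition observable (R : realType) n p (A : 'M[R]_n) (C : 'M[R]_(p, n)) :=
  \rank (\mxcol_(j < n) (C *m A ^+ j)) = n.

(* x_{k+1} = A x_k + B v_k,  o_k = C x_k + D v_k *)
Record lti (R : realType) (nx nin nout : nat) := Lti {
  ltiA : 'M[R]_nx;
  ltiB : 'M[R]_(nx, nin);
  ltiC : 'M[R]_(nout, nx);
  ltiD : 'M[R]_(nout, nin) }.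

Definition minimal (R : realType) nx nin nout (S : lti R nx nin nout) :=
  controllable (ltiA S) (ltiB S) /\ observable (ltiA S) (ltiC S).

(* S1 S2: the output of S2 is fed into S1; the state is (state S1, state S2). *)
Definition cascade (R : realType) n1 n2 p q o
    (S1 : lti R n1 q o) (S2 : lti R n2 p q) : lti R (n1 + n2) p o :=
  Lti (block_mx (ltiA S1) (ltiB S1 *m ltiC S2) 0 (ltiA S2))
      (col_mx (ltiB S1 *m ltiD S2) (ltiB S2))
      (row_mx (ltiC S1) (ltiD S1 *m ltiC S2))
      (ltiD S1 *m ltiD S2).

Definition change_coords (R : realType) n n' p o (S : lti R n p o)
    (Q : 'M[R]_(n, n')) (Qi : 'M[R]_(n', n)) : lti R n' p o :=
  Lti (Qi *m ltiA S *m Q) (Qi *m ltiB S) (ltiC S *m Q) (ltiD S).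

(* nz is the common dimension s * c of w_k and z_k. *)
Record network (R : realType) (n nz nu ny : nat) := Network {
  nA : 'M[R]_n;         nB1 : 'M[R]_(n, nz);   nB2 : 'M[R]_(n, nu);
  nC1 : 'M[R]_(nz, n);  nD1 : 'M[R]_nz;        nD12 : 'M[R]_(nz, nu);
  nC2 : 'M[R]_(ny, n);  nD21 : 'M[R]_(ny, nz); nD2 : 'M[R]_(ny, nu) }.

Definition loop_well_posed (R : realType) n nz nu ny nc
    (P : network R n nz nu ny) (K : lti R nc ny nu) :=
  1%:M - nD2 P *m ltiD K \in unitmx.

(* The map from (x, xi, w) to y is y = M (C2 x + D2 Cc xi + D21 w) with
   M = (I - D2 Dc)^-1, and then u = Cc xi + Dc y. *)
Definition star (R : realType) n nz nu ny nc
    (P : network R n nz nu ny) (K : lti R nc ny nu) : lti R (n + nc) nz nz :=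
  let M := invmx (1%:M - nD2 P *m ltiD K) in
  let yx := M *m nC2 P in
  let yxi := M *m (nD2 P *m ltiC K) in
  let yw := M *m nD21 P in
  let ux := ltiD K *m yx in
  let uxi := ltiC K + ltiD K *m yxi in
  let uw := ltiD K *m yw in
  Lti (block_mx (nA P + nB2 P *m ux) (nB2 P *m uxi)
                (ltiB K *m yx)       (ltiA K + ltiB K *m yxi))
      (col_mx (nB1 P + nB2 P *m uw) (ltiB K *m yw))
      (row_mx (nC1 P + nD12 P *m ux) (nD12 P *m uxi))
      (nD1 P + nD12 P *m uw).

Definition alg_well_posed (R : realType) n nz nu ny nc (F : operator R nz)
    (P : network R n nz nu ny) (K : lti R nc ny nu) :=
  loop_well_posed P K /\
  globally_continuous (inv_op (sub_lin (inv_op F) (ltiD (star P K)))).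

Definition trajectory (R : realType) nx nz (F : operator R nz)
    (S : lti R nx nz nz)
    (x : nat -> 'cV[R]_nx) (w z : nat -> 'cV[R]_nz) :=
  forall k, [/\ x k.+1 = ltiA S *m x k + ltiB S *m w k,
                z k = ltiC S *m x k + ltiD S *m w k
              & F (z k) (w k)].

Definition convergent (R : realType) n s c nu ny nc
    (F : operator R (s * c))
    (P : network R n (s * c) nu ny) (K : lti R nc ny nu) :=
  let S := star P K in
  exists (xs : 'cV[R]_(n + nc)) (ws zs : 'cV[R]_(s * c)) (beta : 'cV[R]_c),
    [/\ xs = ltiA S *m xs + ltiB S *m ws,
        zs = ltiC S *m xs + ltiD S *m ws,
        F zs ws,
        zs = ones_kron R s c *m beta
      & (ones_kron R s c)^T *m ws = 0] /\
    forall x w z, trajectory F S x w z ->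
      (x k, w k, z k) @[k --> \oo] --> (xs, ws, zs).

Definition robustly_stable (R : realType) n s c nu ny nc
    (m : 'I_s -> R) (L : 'I_s -> \bar R)
    (P : network R n (s * c) nu ny) (K : lti R nc ny nu) :=
  loop_well_posed P K /\
  forall F, class_O0 m L F ->
    alg_well_posed F P K /\
    forall x w z, trajectory F (star P K) x w z ->
      x k @[k --> \oo] --> (0 : 'cV[R]_(n + nc)).

Definition consensus_matrix (R : realType) s c
    (N : 'M[R]_(s * c, s.-1 * c)) :=
  \rank N = (s.-1 * c)%N /\ ran N = null (ones_kron R s c)^T.

(* (0  X N); for s >= 1 its number of columns c + s.-1 * c equals s * c. *)
Definition zeroN (R : realType) s c p (X : 'M[R]_(p, s * c))
    (N : 'M[R]_(s * c, s.-1 * c)) : 'M[R]_(p, c + s.-1 * c) :=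
  row_mx 0 (X *m N).

Definition onesN (R : realType) s c (X : 'M[R]_(s * c))
    (N : 'M[R]_(s * c, s.-1 * c)) : 'M[R]_(s * c, c + s.-1 * c) :=
  row_mx (ones_kron R s c) (X *m N).

Definition regulator_eqs (R : realType) n s c nu ny nc
    (P : network R n (s * c) nu ny) (K : lti R nc ny nu)
    (N : 'M[R]_(s * c, s.-1 * c))
    (t : 'M[R]_(n, c + s.-1 * c) * 'M[R]_(nc, c + s.-1 * c) *
         'M[R]_(nu, c + s.-1 * c) * 'M[R]_(ny, c + s.-1 * c)) :=
  let: (Pi, Theta, Gamma, Phi) := t in
  [/\ nA P *m Pi + zeroN (nB1 P) N + nB2 P *m Gamma = Pi,
      nC1 P *m Pi + onesN (nD1 P) N + nD12 P *m Gamma = 0,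
      nC2 P *m Pi + zeroN (nD21 P) N + nD2 P *m Gamma = Phi,
      ltiA K *m Theta + ltiB K *m Phi = Theta
    & ltiC K *m Theta + ltiD K *m Phi = Gamma].

Definition Em (R : realType) n s c nu ny (m : 'I_s -> R)
    (P : network R n (s * c) nu ny) : 'M[R]_(s * c) :=
  1%:M - nD1 P *m diag_kron c m.

Definition Wm (R : realType) n s c nu ny (m : 'I_s -> R)
    (P : network R n (s * c) nu ny) : 'M[R]_(s * c) :=
  diag_kron c m *m invmx (Em m P).

Definition Am (R : realType) n s c nu ny (m : 'I_s -> R)
    (P : network R n (s * c) nu ny) : 'M[R]_n :=
  nA P + nB1 P *m Wm m P *m nC1 P.

Definition B2m (R : realType) n s c nu ny (m : 'I_s -> R)
    (P : network R n (s * c) nu ny) : 'M[R]_(n, nu) :=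
  nB2 P + nB1 P *m Wm m P *m nD12 P.

Definition C2m (R : realType) n s c nu ny (m : 'I_s -> R)
    (P : network R n (s * c) nu ny) : 'M[R]_(ny, n) :=
  nC2 P + nD21 P *m Wm m P *m nC1 P.

Definition B1m (R : realType) n s c nu ny (m : 'I_s -> R)
    (P : network R n (s * c) nu ny) (N : 'M[R]_(s * c, s.-1 * c)) :
    'M[R]_(n, c + s.-1 * c) :=
  zeroN (nB1 P) N + nB1 P *m Wm m P *m onesN (nD1 P) N.

Definition D21m (R : realType) n s c nu ny (m : 'I_s -> R)
    (P : network R n (s * c) nu ny) (N : 'M[R]_(s * c, s.-1 * c)) :
    'M[R]_(ny, c + s.-1 * c) :=
  zeroN (nD21 P) N + nD21 P *m Wm m P *m onesN (nD1 P) N.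

Definition assumption1 (R : realType) n s c nu ny (m : 'I_s -> R)
    (P : network R n (s * c) nu ny) :=
  Em m P \in unitmx.

Definition assumption2 (R : realType) n s c nu ny (m : 'I_s -> R)
    (P : network R n (s * c) nu ny) :=
  stabilizable (Am m P) (B2m m P) /\ detectable (Am m P) (C2m m P).

Definition assumption3 (R : realType) n s c nu ny
    (P : network R n (s * c) nu ny) :=
  \rank (block_mx (nA P - 1%:M) (nB2 P) (nC1 P) (nD12 P)) = (n + nu)%N.

Definition assumption4 (R : realType) n s c nu ny (m : 'I_s -> R)
    (P : network R n (s * c) nu ny) (N : 'M[R]_(s * c, s.-1 * c)) :=
  detectable (block_mx (Am m P) (B1m m P N) 0 1%:M)
             (row_mx (C2m m P) (D21m m P N)).

(* R = (R1 R2) is invertible and its first r = dim null(Phi) columns span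
   null(Phi). *)
Definition null_adapted (R : realType) ny q r k (Phi : 'M[R]_(ny, q))
    (R1 : 'M[R]_(q, r)) (R2 : 'M[R]_(q, k)) :=
  [/\ invertible_mx (row_mx R1 R2), r = dim_null Phi & ran R1 = null Phi].

(* The input is (u^1, u^2) in R^r x R^nu:
   eta_{k+1} = eta_k + u^1_k,  u_k = - Gamma1 eta_k + u^2_k. *)
Definition internal_model (R : realType) nu r (Gamma1 : 'M[R]_(nu, r)) :
    lti R r (r + nu) nu :=
  Lti 1%:M (row_mx 1%:M 0) (- Gamma1) (row_mx 0 1%:M).

Definition core_space (R : realType) nu ny r k l
    (Theta12 : 'M[R]_(r, k)) (Theta22 : 'M[R]_(l, k))
    (Gamma1 : 'M[R]_(nu, r)) (Gamma2 : 'M[R]_(nu, k)) (Phi2 : 'M[R]_(ny, k)) :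
    set (lti R l ny (r + nu)) :=
  [set S | [/\ ltiA S *m Theta22 + ltiB S *m Phi2 = Theta22,
               usubmx (ltiC S) *m Theta22 + usubmx (ltiD S) *m Phi2 = 0
             & dsubmx (ltiC S) *m Theta22 + dsubmx (ltiD S) *m Phi2
               = Gamma1 *m Theta12 + Gamma2]].

(* Main.v *)
Require Import Defs.
From HB Require Import structures.
From mathcomp Require Import all_boot all_order all_algebra.
From mathcomp Require Import complex mxtens.
From mathcomp Require Import all_classical all_reals all_analysis.

Set Implicit Arguments.
Unset Strict Implicit.
Unset Printing Implicit Defensive.

Import Order.TTheory GRing.Theory Num.Theory.
Import numFieldNormedType.Exports.

Local Open Scope classical_set_scope.
Local Open Scope ring_scope.

(**
On [null Phi] the regulator equation [A_c Theta + B_c Phi = Theta] says that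
[Theta] takes values in the fixed points of [A_c], and [C_c Theta + D_c Phi =
Gamma] says that the controller output there is [Gamma]. So once the columns
of [- Theta R1] are independent they can be taken as the first [r] vectors of
a new basis of the controller state space. In that basis [A_c] has first block
column [(I 0)] and [C_c] has first block [- Gamma1], which is exactly the
shape of a cascade whose first factor is a bank of [r] integrators read out
through [- Gamma1]; the remaining blocks of the transformed controller are the
core subcontroller. Its affine constraint is what the two controller equations
become on the columns [R2].

The substance is the independence of the columns of [Theta R1], that is,
[null Theta] and [null Phi] meet only in 0 ([regulator_null_trivial]).  If
[Theta v = 0] and [Phi v = 0] then [Gamma v = 0] as well, and the network
equations say that [(Pi v, v)] is a constant trajectory, with zero measured
output, of the network augmented by a constant exogenous signal.  The second
network equation lets one replace [A] and [C2] by their loop-shifted versions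
without changing this trajectory, so detectability of the augmented pair
([detectable_fixed_point]) forces [v = 0].
*)

(** A fixed vector with zero output stays fixed under every output injection,
so it would give the eigenvalue 1, which is not inside the open unit disc. *)
Lemma detectable_fixed_point (R : realType) n p (A : 'M[R]_n) (C : 'M[R]_(p, n))
    (x : 'cV[R]_n) :
  detectable A C -> A *m x = x -> C *m x = 0 -> x = 0.
Proof.
move=> [G schurG] Ax Cx.
have Mx : (A + G *m C - 1%:M) *m x = 0.
  by rewrite mulmxBl mulmxDl Ax -mulmxA Cx mulmx0 addr0 mul1mx subrr.
have [Munit|Mnunit] := boolP (A + G *m C - 1%:M \in unitmx).
  by rewrite -(mulKmx Munit x) Mx mulmx0.
have /schurG : eigenvalue (map_mx (real_complex R) (A + G *m C)) 1.
  rewrite /eigenvalue /eigenspace kermx_eq0 row_free_unit.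
  by rewrite -(map_mx1 (real_complex R)) -map_mxB map_unitmx.
by rewrite normr1 ltxx.
Qed.

(** A vector killed by [Theta] and [Phi] drives the network with the controller
at rest, and makes [(Pi v, v)] an unobserved equilibrium of the loop-shifted
augmented plant, which detectability excludes. *)
Lemma regulator_null_trivial (R : realType) s c n nu ny nc (m : 'I_s -> R)
    (N : 'M[R]_(s * c, s.-1 * c)) (P : network R n (s * c) nu ny)
    (K : lti R nc ny nu) Pi Theta Gamma Phi (v : 'cV[R]_(c + s.-1 * c)) :
  assumption4 m P N -> regulator_eqs P K N (Pi, Theta, Gamma, Phi) ->
  Theta *m v = 0 -> Phi *m v = 0 -> v = 0.
Proof.
move=> hP4 [eqA eqC1 eqC2 _ eqCc] Tv Pv.
have Gv : Gamma *m v = 0 by rewrite -eqCc mulmxDl -!mulmxA Tv Pv !mulmx0 addr0.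
have {eqA} eqA : nA P *m (Pi *m v) + zeroN (nB1 P) N *m v = Pi *m v.
  by rewrite -[in RHS]eqA !mulmxDl -!mulmxA Gv mulmx0 addr0.
have {eqC1} eqC1 : nC1 P *m (Pi *m v) = - (onesN (nD1 P) N *m v).
  apply/eqP; rewrite -addr_eq0; apply/eqP.
  by have := congr1 (mulmx^~ v) eqC1; rewrite !mulmxDl mul0mx -!mulmxA Gv mulmx0 addr0.
have {eqC2} eqC2 : nC2 P *m (Pi *m v) + zeroN (nD21 P) N *m v = 0.
  by have := congr1 (mulmx^~ v) eqC2; rewrite !mulmxDl Pv -!mulmxA Gv mulmx0 addr0.
(* The two loop-shift terms, in the state and in the exogenous signal, cancel. *)
have shift p (X : 'M[R]_(p, n)) Y (Z : 'M[R]_(p, s * c)) :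
  (X + Z *m nC1 P) *m (Pi *m v) + (Y + Z *m onesN (nD1 P) N) *m v
  = X *m (Pi *m v) + Y *m v.
  by rewrite !mulmxDl -!(mulmxA Z) eqC1 mulmxN addrACA addNr addr0.
have /eqP : col_mx (Pi *m v) v = 0.
  apply: (detectable_fixed_point hP4).
    by rewrite mul_block_col mul0mx mul1mx add0r shift eqA.
  by rewrite mul_row_col shift.
by rewrite col_mx_eq0 => /andP[_ /eqP].
Qed.

Lemma injective_row_free_tr (R : realType) p q (X : 'M[R]_(p, q)) :
  (forall v : 'cV[R]_q, X *m v = 0 -> v = 0) -> row_free X^T.
Proof.
move=> injX; apply: inj_row_free => u uX.
by apply: trmx_inj; rewrite trmx0; apply: injX; rewrite -[X]trmxK -trmx_mul uX trmx0.
Qed.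

Lemma complete_columns (R : realType) p q (X : 'M[R]_(p, q)) :
  row_free X^T -> exists (l : nat) (Y : 'M[R]_(p, l)), invertible_mx (row_mx X Y).
Proof.
move=> freeX; exists (\rank (X^T)^C%MS), (row_base (X^T)^C%MS)^T.
set Y := row_base _.
have full : row_full (col_mx X^T Y).
  by rewrite -sub1mx -addsmxE (adds_eqmx (eqmx_refl _) (eq_row_base _)) sub1mx addsmx_compl_full.
have free : row_free (col_mx X^T Y).
  rewrite /row_free (eqP full) mxrank_compl (eqP freeX).
  by rewrite subnKC // -(eqP freeX) rank_leq_col.
exists (pinvmx (col_mx X^T Y))^T; rewrite -[X in row_mx X]trmxK -tr_col_mx.
by split; rewrite -trmx_mul ?mulVpmx ?mulmxVp ?trmx1.
Qed.

Lemma null_adapted_exists (R : realType) p q (Phi : 'M[R]_(p, q)) :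
  exists (r k : nat) (R1 : 'M[R]_(q, r)) (R2 : 'M[R]_(q, k)), null_adapted Phi R1 R2.
Proof.
pose B := row_base (kermx Phi^T).
have [|k [R2 invR]] := @complete_columns _ _ _ B^T.
  by rewrite trmxK row_base_free.
exists (dim_null Phi), k, B^T, R2; split => //.
apply/seteqP; split => [_ [u _ <-]|v] /=.
  have /sub_kermxP BPhi : (B <= kermx Phi^T)%MS by rewrite eq_row_base.
  rewrite /null /= mulmxA -[Phi *m _]trmxK trmx_mul trmxK BPhi.
  by rewrite trmx0 mul0mx.
move=> Phiv; have /submxP[w vw] : (v^T <= B)%MS.
  by rewrite eq_row_base; apply/sub_kermxP; rewrite -trmx_mul Phiv trmx0.
by exists w^T => //; rewrite -trmx_mul -vw trmxK.
Qed.

(** To be used with [X = Theta R1] and [Y = Theta R2].  The columns of [X] are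
fixed by [A_c], so in a basis that begins with [-X] the first [r] coordinates
are integrators driven by the rest of the controller; whatever drives them is
the first output of the core, and whatever reaches [u] without passing through
them is the second.  Rewriting the two equations for [Y] in this basis gives
the affine constraint, the terms in [Theta12] cancelling in the state equation
and surviving, multiplied by [Gamma1], in the output equation. *)
Lemma integrator_factorization (R : realType) nc ny nu r k l (K : lti R nc ny nu)
    (X : 'M[R]_(nc, r)) (Y : 'M[R]_(nc, k)) (Q2 : 'M[R]_(nc, l)) Qi
    (Gamma1 : 'M[R]_(nu, r)) (Gamma2 : 'M[R]_(nu, k)) (Phi2 : 'M[R]_(ny, k)) :
  inverse_mx (row_mx (- X) Q2) Qi ->
  ltiA K *m X = X -> ltiC K *m X = Gamma1 ->
  ltiA K *m Y + ltiB K *m Phi2 = Y -> ltiC K *m Y + ltiD K *m Phi2 = Gamma2 ->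
  exists Theta12 Theta22 (Score : lti R l ny (r + nu)),
    [/\ Qi *m row_mx X Y = block_mx (- 1%:M) Theta12 0 Theta22,
        core_space Theta12 Theta22 Gamma1 Gamma2 Phi2 Score
      & change_coords K (row_mx (- X) Q2) Qi
        = cascade (internal_model Gamma1) Score].
Proof.
set Q := row_mx _ _ => -[QQi QiQ] AX CX AY CY.
have QiX : Qi *m X = col_mx (- 1%:M) 0.
  have : Qi *m (Q *m col_mx (- 1%:M) 0) = col_mx (- 1%:M) 0.
    by rewrite mulmxA QiQ mul1mx.
  by rewrite mul_row_col mulmx0 addr0 mulNmx mulmxN mulmx1 opprK.
have QX : Q *m (Qi *m X) = X by rewrite mulmxA QQi mul1mx.
set T := Qi *m Y; have QT : Q *m T = Y by rewrite mulmxA QQi mul1mx.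
pose A2 := Qi *m ltiA K *m Q2; pose Bn := Qi *m ltiB K.
have An : Qi *m ltiA K *m Q = block_mx 1%:M (usubmx A2) 0 (dsubmx A2).
  rewrite mul_mx_row -/A2 mulmxN -mulmxA AX QiX opp_col_mx opprK oppr0.
  by rewrite -[in LHS](vsubmxK A2) -block_mxEh.
have Cn : ltiC K *m Q = row_mx (- Gamma1) (ltiC K *m Q2).
  by rewrite mul_mx_row mulmxN CX.
exists (usubmx T), (dsubmx T),
  (Lti (dsubmx A2) (dsubmx Bn) (col_mx (usubmx A2) (ltiC K *m Q2))
       (col_mx (usubmx Bn) (ltiD K))).
split.
- by rewrite mul_mx_row QiX -/T -[in LHS](vsubmxK T) -block_mxEh.
- have : Qi *m ltiA K *m Q *m T + Bn *m Phi2 = T.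
    by rewrite -[_ *m Q *m T]mulmxA QT -!mulmxA -mulmxDr AY.
  rewrite An -{1 2}(vsubmxK T) mul_block_col mul1mx mul0mx add0r.
  rewrite -[in LHS](vsubmxK Bn) mul_col_mx add_col_mx => /eq_col_mx[eq1 eq2].
  have := CY; rewrite -QT mulmxA Cn -{1}(vsubmxK T) mul_row_col mulNmx => eq3.
  rewrite /core_space /= !col_mxKu !col_mxKd; split => //.
    by apply: (addrI (usubmx T)); rewrite addrA eq1 addr0.
  by rewrite -eq3 !addrA addrN add0r.
- rewrite /change_coords /cascade /internal_model /= An Cn -/Bn.
  by rewrite !mul_row_col !mul1mx !mul0mx !addr0 !add0r vsubmxK.
Qed.

Theorem theorem5p1 (R : realType) (s c : nat) (hs : (1 <= s)%N) (hc : (1 <= c)%N)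
    (m : 'I_s -> R) (L : 'I_s -> \bar R)
    (hmL : forall i, ((m i)%:E < L i)%E) (hm : 0 < \sum_i m i)
    (N : 'M[R]_(s * c, s.-1 * c)) (hN : consensus_matrix N)
    (n nu ny : nat) (P : network R n (s * c) nu ny)
    (hP1 : assumption1 m P) (hP2 : assumption2 m P)
    (hP3 : assumption3 P) (hP4 : assumption4 m P N)
    (nc : nat) (K : lti R nc ny nu) (hK : minimal K)
    (hconv : forall F, class_O m L F -> alg_well_posed F P K /\ convergent F P K)
    (hstab : robustly_stable m L P K)
    (Pi : 'M[R]_(n, c + s.-1 * c)) (Theta : 'M[R]_(nc, c + s.-1 * c))
    (Gamma : 'M[R]_(nu, c + s.-1 * c)) (Phi : 'M[R]_(ny, c + s.-1 * c))
    (hreg : unique (regulator_eqs P K N) (Pi, Theta, Gamma, Phi)) :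
  (exists (r k : nat) (R1 : 'M[R]_(c + s.-1 * c, r)) (R2 : 'M[R]_(c + s.-1 * c, k)),
      null_adapted Phi R1 R2) /\
  forall (r k : nat) (R1 : 'M[R]_(c + s.-1 * c, r)) (R2 : 'M[R]_(c + s.-1 * c, k))
      (Gamma1 : 'M[R]_(nu, r)) (Gamma2 : 'M[R]_(nu, k)) (Phi2 : 'M[R]_(ny, k)),
    null_adapted Phi R1 R2 ->
    Gamma *m row_mx R1 R2 = row_mx Gamma1 Gamma2 ->
    Phi *m row_mx R1 R2 = row_mx 0 Phi2 ->
    exists (l : nat) (Q : 'M[R]_(nc, r + l)) (Qi : 'M[R]_(r + l, nc))
        (Theta12 : 'M[R]_(r, k)) (Theta22 : 'M[R]_(l, k))
        (Score : lti R l ny (r + nu)),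
      [/\ inverse_mx Q Qi,
          Qi *m Theta *m row_mx R1 R2 = block_mx (- 1%:M) Theta12 0 Theta22,
          core_space Theta12 Theta22 Gamma1 Gamma2 Phi2 Score
        & change_coords K Q Qi = cascade (internal_model Gamma1) Score].
Proof.
split; first exact: null_adapted_exists.
move=> r k R1 R2 Gamma1 Gamma2 Phi2 [[Ri [_ RiR]] _ _].
have [reg _] := hreg; have [_ _ _ eqA eqC] := reg.
rewrite !mul_mx_row => /eq_row_mx[GR1 GR2] /eq_row_mx[PR1 PR2].
have freeX : row_free (- (Theta *m R1))^T.
  apply: injective_row_free_tr => v /eqP.
  rewrite mulNmx oppr_eq0 -mulmxA => /eqP TRv.
  have R1v : R1 *m v = 0.
    by apply: (regulator_null_trivial hP4 reg TRv); rewrite mulmxA PR1 mul0mx.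
  have : Ri *m (row_mx R1 R2 *m col_mx v 0) = col_mx v 0.
    by rewrite mulmxA RiR mul1mx.
  rewrite mul_row_col R1v !mulmx0 addr0 mulmx0 => /esym/eqP.
  by rewrite col_mx_eq0 => /andP[/eqP].
have [l [Q2 [Qi invQ]]] := complete_columns freeX.
have [|||| T12 [T22 [S [eqT coreS KS]]]] :=
  @integrator_factorization _ _ _ _ _ _ _ K _ (Theta *m R2) _ _ Gamma1 Gamma2 Phi2 invQ.
- by rewrite -[in RHS]eqA mulmxDl -!mulmxA PR1 mulmx0 addr0.
- by rewrite -GR1 -eqC mulmxDl -!mulmxA PR1 mulmx0 addr0.
- by rewrite -[in RHS]eqA mulmxDl -!mulmxA PR2.
- by rewrite -GR2 -eqC mulmxDl -!mulmxA PR2.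
exists l, (row_mx (- (Theta *m R1)) Q2), Qi, T12, T22, S; split=> //.
by rewrite -mulmxA mul_mx_row.
Qed.
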